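(* $h(n) = (n-1)/2$ for each of the following values of $n$: $n = 31, 43, 67, 79, 131, 139, 151, 163, 191, 199, 211, 223, 283, 307, 331, 367, 379, 439, 463, 487, 499, 523, 547, 607, 619, 643, 691, 727, 739, 751, 787, 811, 823, 859, 907, 919, 967$.
   Context: $A_n$ is the alternating group of degree $n$, acting on $\mathbb{Z}_n = \mathbb{Z}/n\mathbb{Z} = \{0,1,\ldots,n-1\}$. Permutations act on the right (the image of $x$ under $\pi$ is $x^\pi$) and are composed from left to right. For $n$ odd, let $c = (0,1,\ldots,n-1) \in A_n$, i.e. $x^c = x+1$. For $\pi \in A_n$, $[\pi] = \langle c\rangle \pi$ is the coset of $\langle c \rangle$ containing $\pi$; its elements are the permutations $c^j\pi$ (first $c^j$, then $\pi$). Define $h(\pi)$ to be the minimum number of 3-cycles in an expression of $\pi$ as a product of (not necessarily disjoint) 3-cycles in $A_n$, with $h(\mathrm{id}) = 0$. Define $h([\pi]) = \min_{\sigma \in [\pi]} h(\sigma) = \min_{0 \le j \le n-1} h(c^j\pi)$ and $h(n) = \max_{\pi \in A_n} h([\pi])$. *)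

(* Defs.v *)
From HB Require Import structures.
From mathcomp Require Import all_boot all_order all_algebra all_fingroup all_solvable.

Set Implicit Arguments.
Unset Strict Implicit.
Unset Printing Implicit Defensive.

Import GRing.Theory.
Import GroupScope.

Section ThreeCycles.

Variable T : finType.
Implicit Types (s p : {perm T}) (k : nat).

Definition three_cycle s : bool :=
  [exists x, exists y, exists z,
    [&& uniq [:: x; y; z], s x == y, s y == z, s z == x &
      [forall w, (w \notin [:: x; y; z]) ==> (s w == w)]]].

Definition prod3 k p : bool :=
  [exists t : k.-tuple {perm T},
    all three_cycle t && (p == \prod_(s <- t) s)].

Lemma three_cycle_tperm (x y z : T) :
  uniq [:: x; y; z] -> three_cycle (tperm x y * tperm x z).
Proof.
move=> U; have := U; rewrite /= !inE negb_or !andbT => /andP[/andP[xy xz] yz].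
apply/existsP; exists x; apply/existsP; exists y; apply/existsP; exists z.
rewrite U !permM tpermL tpermR tpermL.
rewrite (tpermD xy) 1?eq_sym // (tpermD xz) // tpermR !eqxx /=.
apply/forallP => w; apply/implyP; rewrite !inE !negb_or => /and3P[wx wy wz].
by rewrite permM !tpermD // eq_sym.
Qed.

Lemma prod3_mul k l p s : prod3 k p -> prod3 l s -> prod3 (k + l) (p * s).
Proof.
move=> /existsP[t /andP[at_ /eqP->]] /existsP[u /andP[au /eqP->]].
apply/existsP; exists [tuple of t ++ u].
by rewrite all_cat at_ au /= big_cat.
Qed.

Lemma prod3_1 : prod3 0 1.
Proof. by apply/existsP; exists [tuple]; rewrite /= big_nil. Qed.

Lemma prod3_tperm_common (a b c : T) :
  a != b -> a != c -> exists k, prod3 k (tperm a b * tperm a c).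
Proof.
move=> ab ac; have [<-|bc] := eqVneq b c.
  by exists 0; rewrite tperm2; apply: prod3_1.
exists 1%N; apply/existsP; exists [tuple tperm a b * tperm a c].
rewrite big_seq1 eqxx /= !andbT.
by apply: three_cycle_tperm; rewrite /= !inE negb_or ab ac bc.
Qed.

Lemma prod3_tperm (a b c d : T) :
  a != b -> c != d -> exists k, prod3 k (tperm a b * tperm c d).
Proof.
move=> ab cd; have [eq_ac|ac] := eqVneq a c.
  by rewrite -eq_ac in cd *; apply: prod3_tperm_common.
have [k Hk] := prod3_tperm_common ab ac.
have [|l Hl] := @prod3_tperm_common c a d _ cd; first by rewrite eq_sym.
exists (k + l); have := prod3_mul Hk Hl.
by rewrite (tpermC c a) -mulgA (mulgA (tperm a c)) tperm2 mul1g.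
Qed.

Lemma prod3_exists p : exists k, (p \in 'Alt_T) ==> prod3 k p.
Proof.
rewrite Alt_even /=; have [|odd_p] := boolP (odd_perm p); first by exists 0.
have [ts def_p ts_ok] := prod_tpermP p.
move: odd_p; rewrite def_p odd_perm_prod // => /=.
move: {2}(size ts) (leqnn (size ts)) => m; elim: m ts ts_ok {def_p} => [|m IHm] ts ts_ok.
  by rewrite leqn0 => /nilP-> _; exists 0; rewrite big_nil; apply: prod3_1.
case: ts ts_ok => [|[a b] [|[c d] ts]] //=.
  by move=> _ _ _; exists 0; rewrite big_nil; apply: prod3_1.
move=> /and3P[ab cd ts_ok] le_m; rewrite negbK => ev.
have [k Hk] := prod3_tperm ab cd.
have [l Hl] := IHm ts ts_ok (ltnW le_m) ev.
by exists (k + l); rewrite !big_cons mulgA; apply: prod3_mul.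
Qed.

(* The guard makes [h] total: it is the least k with [prod3 k p] when p is
   even, and the junk value 0 when p is odd. *)
Definition h p : nat := ex_minn (prod3_exists p).

End ThreeCycles.

(* x |-> x + 1. Note that 'Z_n is Z/nZ only for 1 < n. *)
Definition cyc (n : nat) : {perm 'Z_n} := perm (@addIr 'Z_n 1%R).

(* Permutations act on the right in MathComp, (p * s) x = s (p x), so the right
   coset consists of the cyc n ^+ j * p. The seed of the minimum is itself one
   of the values, as p lies in its coset. *)
Definition h_coset (n : nat) (p : {perm 'Z_n}) : nat :=
  \big[minn/h p]_(s in <[cyc n]> :* p) h s.

Definition h_max (n : nat) : nat := \max_(p in 'Alt_('Z_n)) h_coset p.

(* Main.v *)
Require Import Defs.
From mathcomp Require Import all_boot all_order all_algebra all_fingroup all_solvable.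
From mathcomp Require Import zify.
From Stdlib Require Import NArith FMapPositive.

(* Colour the n points with two colours.  The number of points at which a
   permutation s changes the colour is even, is 0 for the identity, and grows
   by at most 2 when s is multiplied by a 3-cycle (it can grow by 3 at most, and
   is even).  Hence h(s) >= (n-1)/2 as soon as some colouring is changed by s at
   all points but one, i.e. as soon as s has exactly one odd cycle.  Conversely
   an even permutation moving m points is a product of at most m/2 3-cycles.

   It remains to find, for each n, an even p such that every x |-> p (x + j) has
   exactly one odd cycle.  Let H = <u> be the subgroup of index 3 or 5 of the
   units of Z/nZ, with coset representatives r_i, and let p fix 0 and be
   x |-> a_i x on r_i H.  Then p commutes with the multiplication by u, so j
   and u j are equivalent, and only j = 0 and j = r_i have to be inspected.  The
   a_i were found by a random search. *)

Set Implicit Arguments.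
Unset Strict Implicit.
Unset Printing Implicit Defensive.

Import GRing.Theory GroupScope.

(** * Colour changes and the lower bound on [h] *)

Section Colorings.

Variable T : finType.
Implicit Types (s t p : {perm T}) (chi : T -> bool).

Definition switches chi s : {set T} := [set x | chi (s x) != chi x].

Lemma odd_card (A : {set T}) : odd #|A| = \big[addb/false]_x (x \in A).
Proof.
rewrite -sum1_card big_mkcond (big_morph odd oddD erefl) /=.
by apply: eq_bigr => x _; case: ifP.
Qed.

(** Modulo 2 the number of switches is the sum of [chi (s x) (+) chi x] over all [x]; reindexing the
    first half by [s] turns it into the second, so the two cancel. *)
Lemma switches_even chi s : ~~ odd #|switches chi s|.
Proof.
rewrite odd_card.
have -> : \big[addb/false]_x (x \in switches chi s)
        = \big[addb/false]_x (chi (s x) (+) chi x).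
  by apply: eq_bigr => x _; rewrite inE; case: (chi x) (chi (s x)) => [] [].
rewrite big_split /=.
have -> : \big[addb/false]_x chi (s x) = \big[addb/false]_x chi x.
  by rewrite [RHS](reindex_inj (@perm_inj _ s)).
by rewrite addbb.
Qed.

Lemma switches_mul3 chi s t :
  three_cycle t -> #|switches chi (t * s)| <= #|switches chi s| + 2.
Proof.
case/existsP=> x /existsP[y /existsP[z /and5P[_ _ _ _ /forallP tfix]]].
(* Outside the three points of [t], the permutations [t * s] and [s] agree; parity then improves 3
   to 2. *)
have: #|switches chi (t * s)| <= #|switches chi s| + 3.
  have le3 : #|[set x; y; z]| <= 3.
    by rewrite -setUA cardsU1 cards2; case: (x \notin _); case: (y != z).
  apply: leq_trans (leq_add (leqnn _) le3).
  apply: leq_trans (leq_card_setU _ _); apply: subset_leq_card.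
  apply/subsetP => w; rewrite !inE permM.
  have := tfix w; rewrite !inE -orbA.
  by case: (_ || _) => /=; rewrite ?orbT // orbF => /eqP->.
have := switches_even chi (t * s); have := switches_even chi s.
by move: #|_| #|_| => a b; lia.
Qed.

Lemma switches_prod3 chi k p : prod3 k p -> #|switches chi p| <= k.*2.
Proof.
case/existsP=> -[ts /= /eqP <-] /andP[+ /eqP->].
elim: ts => [|t ts IH] /= => [_|/andP[t3 /IH le_ts]].
  rewrite big_nil leqn0 cards_eq0; apply/eqP/setP => x.
  by rewrite !inE perm1 eqxx.
rewrite big_cons; apply: leq_trans (switches_mul3 _ _ t3) _; lia.
Qed.

Lemma h_prod3 p : p \in 'Alt_T -> prod3 (h p) p.
Proof. by rewrite /h; case: ex_minnP => k + _ => /implyP. Qed.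

Lemma h_leq k p : prod3 k p -> h p <= k.
Proof. by rewrite /h; case: ex_minnP => m _ + pk; apply; rewrite pk implybT. Qed.

Lemma h_lower_bound chi p x0 :
    p \in 'Alt_T -> (forall x, x != x0 -> chi (p x) != chi x) ->
  #|T|.-1 <= (h p).*2.
Proof.
move=> /h_prod3/(switches_prod3 chi) le_h chiP; apply: leq_trans le_h.
rewrite -cardsT (cardsD1 x0) inE add1n /=; apply: subset_leq_card.
by apply/subsetP => x; rewrite !inE andbT; apply: chiP.
Qed.

(** * Moved points and the upper bound on [h] *)

Definition moved s : {set T} := [set x | s x != x].

Lemma prod3_three_cycle s : three_cycle s -> prod3 1 s.
Proof. by move=> s3; apply/existsP; exists [tuple s]; rewrite /= s3 big_seq1 eqxx. Qed.

Lemma moved_eq0 s : moved s = set0 -> s = 1.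
Proof.
move=> /setP s0; apply/permP => x; rewrite perm1; apply/eqP.
by have := s0 x; rewrite !inE; case: eqP.
Qed.

(** Inserting (a c)(c a) = 1 in the middle gives two products of transpositions with a common
    point. *)
Lemma prod3_double_tperm (a b c d : T) :
  uniq [:: a; b; c; d] -> prod3 2 (tperm a b * tperm c d).
Proof.
rewrite /= !inE !negb_or -!andbA => /and5P[ab ac ad bc /and3P[bd cd _]].
have -> : tperm a b * tperm c d
        = (tperm a b * tperm a c) * (tperm c a * tperm c d).
  by rewrite (tpermC c a) -mulgA (mulgA (tperm a c)) tperm2 mul1g.
apply: (@prod3_mul _ 1 1); apply/prod3_three_cycle/three_cycle_tperm.
  by rewrite /= !inE negb_or ab ac bc.
by rewrite /= !inE negb_or (eq_sym c a) ac cd ad.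
Qed.

(** Each 3-cycle spent must fix two more points. If some cycle of [p] has length at least 3,
    dividing by a 3-cycle along it does so. Otherwise [p] is an even involution, and two of its
    transpositions are removed together: four points for two 3-cycles. *)
Lemma prod3_moved p :
  ~~ odd_perm p -> exists2 k, k.*2 <= #|moved p| & prod3 k p.
Proof.
have [m] := ubnP #|moved p|; elim: m p => // m IH p lt_m even_p.
have step k s : 0 < k -> prod3 k s -> ~~ odd_perm s ->
    #|moved (p * s^-1)| + k.*2 <= #|moved p| ->
  exists2 k, k.*2 <= #|moved p| & prod3 k p.
  move=> k0 sk es le_p.
  have [||l le_l pl] := IH (p * s^-1); [lia | |].
    by rewrite odd_permM odd_permV (negbTE even_p) (negbTE es).
  exists (l + k); first lia.
  by have := prod3_mul pl sk; rewrite mulgKV.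
case: (pickP (fun x => p (p x) != x)) => [x ppx|invol].
  have px : p x != x by apply: contraNneq ppx => pxx; rewrite !pxx.
  pose y := p x; pose z := p y.
  have xy : x != y by rewrite eq_sym.
  have yz : y != z by rewrite /z (inj_eq perm_inj).
  have xz : x != z by rewrite eq_sym.
  have U : uniq [:: x; y; z] by rewrite /= !inE negb_or xy xz yz.
  apply: (step 1%N (tperm x y * tperm x z)) => //.
  - exact/prod3_three_cycle/three_cycle_tperm.
  - by rewrite odd_permM !odd_tperm xy xz.
  (* No new point gets moved: [x], [y], [z] are all moved by [p], so a fixed point of [p] is none of
     them. *)
  have sV w : p w = w -> (p * (tperm x y * tperm x z)^-1) w = w.
    move=> pw; rewrite invMg !tpermV !permM pw.
    have wx : w != x by apply: contraNneq px => <-; rewrite pw.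
    have wy : w != y.
      apply: contraNneq px => wy; apply/eqP; apply: (@perm_inj _ p).
      by rewrite -/y -wy pw.
    have wz : w != z.
      apply: contraNneq wy => wz; rewrite wz; apply/eqP; apply: (@perm_inj _ p).
      by rewrite -/z -wz pw.
    by rewrite !tpermD // eq_sym.
  have sub : moved (p * (tperm x y * tperm x z)^-1) \subset moved p :\ x :\ y.
    apply/subsetP => w; rewrite 3!inE 2!inE.
    have [-> |wy] := eqVneq w y.
      rewrite invMg !tpermV !permM -/z tpermR tpermL eqxx //.
    have [-> |wx] := eqVneq w x.
      by rewrite invMg !tpermV !permM -/y (tpermD xy) 1?eq_sym // tpermR eqxx.
    by rewrite !inE /=; apply: contraNN => /eqP/sV ->.
  have := subset_leq_card sub.
  have yp : y \in moved p :\ x by rewrite !inE eq_sym xy eq_sym.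
  have xp : x \in moved p by rewrite inE.
  have := cardsD1 y (moved p :\ x); have := cardsD1 x (moved p).
  by rewrite xp yp => -> -> le_p; rewrite !add1n !addnS addn0 !ltnS.
have pK x : p (p x) = x by have /negbFE/eqP := invol x.
have [p0|[x]] := set_0Vmem (moved p).
  by exists 0 => //; rewrite (moved_eq0 p0); apply: prod3_1.
rewrite inE => px; pose y := p x; have xy : x != y by rewrite eq_sym.
(* A second transposition exists, since a single one would be odd. *)
have [p_xy|[z]] := set_0Vmem (moved p :\ x :\ y).
  suff def_p : p = tperm x y by rewrite def_p odd_tperm xy in even_p.
  apply/permP => w; case: tpermP => [->|->|/eqP wx /eqP wy] //; first exact: pK.
  by have /setP/(_ w) := p_xy; rewrite !inE wx wy /=; case: eqP.
rewrite !inE => /and3P[zy zx pz]; pose t := p z.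
have zt : z != t by rewrite eq_sym.
have py : p y = x by rewrite /y pK.
have pt : p t = z by rewrite /t pK.
have tx : t != x by rewrite -py (inj_eq perm_inj).
have ty : t != y by rewrite (inj_eq perm_inj).
have U : uniq [:: x; y; z; t].
  by rewrite /= !inE !negb_or xy zt ![x == _]eq_sym ![y == _]eq_sym tx ty zx zy.
apply: (step 2 (tperm x y * tperm z t)) => //.
- exact: prod3_double_tperm.
- by rewrite odd_permM !odd_tperm xy zt.
have sub : moved (p * (tperm x y * tperm z t)^-1) \subset
           moved p :\ x :\ y :\ z :\ t.
  have [xz [yz [xt yt]]] : x != z /\ y != z /\ x != t /\ y != t.
    by do !split; rewrite eq_sym.
  have qE w : (p * (tperm x y * tperm z t)^-1) w = tperm x y (tperm z t (p w)).
    by rewrite invMg !tpermV !permM.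
  apply/subsetP => w; rewrite inE qE !in_setD1.
  have [->|wt] := eqVneq w t; first by rewrite pt tpermL tpermD ?eqxx.
  have [->|wz] := eqVneq w z; first by rewrite tpermR tpermD ?eqxx.
  have [->|wy] := eqVneq w y.
    by rewrite py (@tpermD _ z t x) ?tpermL ?eqxx // eq_sym.
  have [->|wx] := eqVneq w x.
    by rewrite -/y (@tpermD _ z t y) ?tpermR ?eqxx // eq_sym.
  by rewrite inE; apply: contraNN => /eqP->; rewrite !tpermD // eq_sym.
have := subset_leq_card sub.
have xp : x \in moved p by rewrite inE.
have yp : y \in moved p :\ x by rewrite !inE py xy eq_sym xy.
have zp : z \in moved p :\ x :\ y by rewrite !inE zy zx pz.
have tp : t \in moved p :\ x :\ y :\ z by rewrite !inE pt tx ty zt eq_sym zt.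
have := cardsD1 t (moved p :\ x :\ y :\ z).
have := cardsD1 z (moved p :\ x :\ y).
have := cardsD1 y (moved p :\ x); have := cardsD1 x (moved p).
by rewrite xp yp zp tp => -> -> -> -> le_p; rewrite !add1n !addnS addn0 !ltnS.
Qed.

Lemma h_upper_bound p : p \in 'Alt_T -> (h p).*2 <= #|T|.
Proof.
rewrite Alt_even => /prod3_moved[k le_k /h_leq le_h].
apply: leq_trans (max_card (moved p)); apply: leq_trans le_k.
by rewrite leq_double.
Qed.

End Colorings.

(** * Reduction of [h_max n] to a single permutation *)

Section CosetsOfCyc.

Variable n : nat.
Hypothesis n_gt1 : 1 < n.

Lemma cycX k (x : 'Z_n) : (cyc n ^+ k) x = (x + k%:R)%R.
Proof.
elim: k => [|k IH]; first by rewrite perm1 addr0.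
by rewrite expgSr permM IH permE -addrA natr1.
Qed.

Lemma cyc_even : odd n -> cyc n \in 'Alt_('Z_n).
Proof.
move=> odd_n; have cyc_n : cyc n ^+ n = 1.
  by apply/permP => x; rewrite cycX perm1 pchar_Zp // addr0.
(* As n is odd and c^n = 1, c = c^(n+1) is a power of the even permutation c^2. *)
have -> : cyc n = (cyc n ^+ 2) ^+ n.+1./2.
  by rewrite -expgM mul2n even_halfK /= ?odd_n // expgS cyc_n mulg1.
by apply: groupX; rewrite Alt_even expgS expg1 odd_permM addbb.
Qed.

Definition alternates_at (p : {perm 'Z_n}) (j : 'Z_n) : Prop :=
  exists chi : 'Z_n -> bool, exists x0,
    forall x, x != x0 -> chi (p (x + j)%R) != chi x.

Lemma h_max_alternates (p : {perm 'Z_n}) :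
    odd n -> p \in 'Alt_('Z_n) -> (forall j, alternates_at p j) ->
  h_max n = (n - 1) %/ 2.
Proof.
move=> odd_n p_even p_alt; have card_n : #|'Z_n| = n by rewrite card_ord Zp_cast.
apply/eqP; rewrite eqn_leq; apply/andP; split.
  apply/bigmax_leqP => q /h_upper_bound; rewrite card_n => le_hq.
  (* As n is odd, 2 h(q) <= n gives h(q) <= (n-1)/2; the seed [h q] then bounds the minimum over the
     coset. *)
  apply: (@leq_trans (h q)); last by lia.
  by rewrite /h_coset; elim/big_rec: _ => // s m _ le_m; rewrite geq_min le_m orbT.
have lower s : s \in <[cyc n]> :* p -> (n - 1) %/ 2 <= h s.
  case/rcosetP=> _ /cycleP[k ->] ->.
  have even_s : cyc n ^+ k * p \in 'Alt_('Z_n).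
    by rewrite groupM // groupX // cyc_even.
  (* The coset element c^k p is x |-> p (x + k), so the colouring wanted is the one for j = k. *)
  have [chi [x0 chiP]] := p_alt k%:R%R.
  have := @h_lower_bound _ chi _ x0 even_s.
  rewrite card_n => low.
  have : n.-1 <= (h (cyc n ^+ k * p)).*2.
    by apply: low => x /chiP; rewrite permM cycX.
  move: (h _) => m; lia.
apply: leq_trans (leq_bigmax_cond _ p_even); rewrite /h_coset.
elim/big_ind: _ => [|a b|s]; last exact: lower.
  exact/lower/rcoset_refl.
by rewrite leq_min => -> ->.
Qed.

(** Since p (u x + u j) = u p (x + j), multiplication by [u] carries a colouring for [j] to one for
    [u j]; [v] is the inverse of [u]. *)
Lemma alternates_at_mul (p : {perm 'Z_n}) (u v j : 'Z_n) :
    (v * u = 1)%R -> (forall x, p (u * x)%R = (u * p x)%R) ->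
  alternates_at p j -> alternates_at p (u * j)%R.
Proof.
move=> vu pu [chi [x0 chiP]].
exists (fun x => chi (v * x)%R), (u * x0)%R => x neq_x.
have uvK y : (u * (v * y) = y)%R by rewrite mulrA [(u * v)%R]mulrC vu mul1r.
rewrite -{1}(uvK x) -mulrDr pu mulrA vu mul1r; apply: chiP.
by apply: contraNneq neq_x => <-; rewrite uvK.
Qed.

End CosetsOfCyc.

(** * Computing the permutations and their colourings *)

(* Points absent from the map are fixed, so the empty map is the identity. *)
Definition look (m : PositiveMap.t N) (x : N) : N :=
  if PositiveMap.find (N.succ_pos x) m is Some y then y else x.

Definition store (x y : N) (m : PositiveMap.t N) : PositiveMap.t N :=
  PositiveMap.add (N.succ_pos x) y m.

(* [swap (i, j) m] is the map of (i j) followed by m. *)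
Definition swap (t : N * N) (m : PositiveMap.t N) : PositiveMap.t N :=
  store t.1 (look m t.2) (store t.2 (look m t.1) m).

Definition table (ts : seq (N * N)) := foldr swap (PositiveMap.empty N) ts.

Fixpoint range (x : N) (k : nat) : seq N :=
  if k is k'.+1 then x :: range (N.succ x) k' else [::].

Fixpoint geom (n u x : N) (k : nat) : seq N :=
  if k is k'.+1 then x :: geom n u (N.modulo (N.mul u x) n) k' else [::].

(** [k] is fuel, n being enough as no cycle is longer; [seen] is a set encoded as a map. *)
Fixpoint trace (s : N -> N) (k : nat) (x : N) (seen : PositiveMap.t N) :=
  if k is k'.+1 then
    if PositiveMap.mem (N.succ_pos x) seen then ([::], seen) else
    let: (c, seen') := trace s k' (s x) (store x x seen) in (x :: c, seen')
  else ([::], seen).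

Definition cycles (n : N) (s : N -> N) : seq (seq N) :=
  (foldl (fun st x => let: (c, seen) := trace s (N.to_nat n) x st.2 in
                      (c :: st.1, seen))
         ([::], PositiveMap.empty N) (range 0 (N.to_nat n))).1.

(** With left-to-right composition, the cycle (x y_1 ... y_m) is (x y_1)(x y_2)...(x y_m). *)
Definition tperms (cs : seq (seq N)) : seq (N * N) :=
  flatten [seq (if c is x :: c' then [seq (x, y) | y <- c'] else [::]) | c <- cs].

(** Colouring every second point of a cycle alternates along it; an odd cycle has one clash, from
    its last point to its first. *)
Fixpoint evens (c : seq N) : seq N :=
  if c is x :: c' then x :: (if c' is _ :: c'' then evens c'' else [::])
  else [::].

(* Only [check] relies on this: that the colouring changes everywhere but at one
   point is tested, so nothing has to be proved about [cycles] and [evens]. *)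
Definition coloring (n : N) (s : N -> N) : N -> bool :=
  let m := foldr (fun x => store x x) (PositiveMap.empty N)
                 (flatten (map evens (cycles n s))) in
  fun x => PositiveMap.mem (N.succ_pos x) m.

Definition alternates (n : N) (f : N -> N) (r : N) : bool :=
  let s x := f (N.modulo (N.add x r) n) in
  let chi := coloring n s in
  size [seq x <- range 0 (N.to_nat n) | eqb (chi (s x)) (chi x)] <= 1.

(* (n, u, [:: (r_1, a_1); ...; (r_k, a_k)]) *)
Definition witness : Type := N * N * seq (N * N).

(** [k] is the order of H, whose index is [size ra]; each list runs through a coset r H. *)
Definition cosets (w : witness) : seq (N * seq N) :=
  let: (n, u, ra) := w in
  let k := (N.to_nat n).-1 %/ size ra in
  [seq (r.2, geom n u r.1 k) | r <- ra].

(** For a valid witness 0 lies in none of the cosets, so it is absent from the map and hence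
    fixed. *)
Definition witness_fun (w : witness) : N -> N :=
  let: (n, u, ra) := w in
  look (foldr (fun c m =>
          foldr (fun x => store x (N.modulo (N.mul c.1 x) n)) m c.2)
        (PositiveMap.empty N) (cosets w)).

Definition witness_tperms (w : witness) : seq (N * N) :=
  tperms (cycles w.1.1 (witness_fun w)).

(* p is rebuilt from the transpositions [ts], which makes it a permutation of
   known parity whatever [witness_fun] is. *)
Definition check (w : witness) : bool :=
  let: (n, u, ra) := w in
  let ts := witness_tperms w in
  let f := look (table ts) in
  let R := range 0 (N.to_nat n) in
  let k := (N.to_nat n).-1 %/ size ra in
  [&& N.ltb 1 n && odd (N.to_nat n),
      ~~ odd (size ts) &&
        all (fun t => [&& ~~ N.eqb t.1 t.2, N.ltb t.1 n & N.ltb t.2 n]) ts,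
      all (fun x => N.ltb (f x) n
          && N.eqb (f (N.modulo (N.mul u x) n)) (N.modulo (N.mul u (f x)) n)) R,
      N.eqb (N.modulo (N.mul (last u (geom n u 1 k)) u) n) 1,
      all (alternates n f) (0%num :: map fst ra) &
      sort N.leb (flatten (map snd (cosets w))) == range 1 (N.to_nat n).-1].

(** Each [u] is the cube (three cosets) or the fifth power (five cosets) of a primitive root modulo
    the prime n. *)
Definition witnesses : seq witness :=
  [:: (31, 26, [:: (1, 20); (2, 3); (3, 13); (4, 28); (8, 2)]);
      (43, 27, [:: (1, 24); (3, 26); (7, 22)]);
      (67, 8, [:: (1, 7); (2, 5); (4, 65)]);
      (79, 27, [:: (1, 77); (2, 26); (4, 14)]);
      (131, 32, [:: (1, 35); (2, 123); (3, 8); (6, 51); (9, 109)]);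
      (139, 8, [:: (1, 84); (2, 66); (3, 17)]);
      (151, 65, [:: (1, 6); (2, 39); (4, 131)]);
      (163, 8, [:: (1, 153); (2, 69); (3, 5)]);
      (191, 166, [:: (1, 92); (2, 45); (3, 40); (4, 95); (8, 63)]);
      (199, 27, [:: (1, 169); (2, 88); (4, 95)]);
      (211, 8, [:: (1, 7); (2, 139); (4, 198)]);
      (223, 27, [:: (1, 50); (3, 44); (5, 95)]);
      (283, 27, [:: (1, 205); (3, 183); (5, 73)]);
      (307, 125, [:: (1, 35); (5, 80); (7, 7)]);
      (331, 27, [:: (1, 121); (2, 208); (4, 116)]);
      (367, 216, [:: (1, 214); (2, 116); (4, 21)]);
      (379, 8, [:: (1, 172); (2, 336); (3, 240)]);
      (439, 302, [:: (1, 330); (5, 211); (11, 414)]);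
      (463, 27, [:: (1, 428); (2, 38); (4, 378)]);
      (487, 27, [:: (1, 343); (2, 153); (4, 146)]);
      (499, 343, [:: (1, 473); (5, 113); (11, 132)]);
      (523, 8, [:: (1, 320); (2, 235); (4, 269)]);
      (547, 8, [:: (1, 361); (2, 120); (4, 148)]);
      (607, 27, [:: (1, 504); (2, 300); (3, 606)]);
      (619, 8, [:: (1, 435); (2, 191); (4, 584)]);
      (643, 45, [:: (1, 145); (7, 136); (11, 300)]);
      (691, 27, [:: (1, 199); (3, 319); (7, 26)]);
      (727, 125, [:: (1, 250); (5, 690); (13, 298)]);
      (739, 27, [:: (1, 558); (3, 333); (9, 659)]);
      (751, 27, [:: (1, 536); (2, 345); (3, 295)]);
      (787, 8, [:: (1, 456); (2, 631); (4, 220)]);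
      (811, 27, [:: (1, 657); (3, 716); (5, 601)]);
      (823, 27, [:: (1, 508); (2, 403); (4, 45)]);
      (859, 8, [:: (1, 561); (2, 615); (3, 123)]);
      (907, 8, [:: (1, 802); (2, 180); (4, 258)]);
      (919, 343, [:: (1, 315); (5, 135); (7, 598)]);
      (967, 125, [:: (1, 764); (2, 684); (4, 913)])]%num.

(** * Correctness of the computation, read in Z/nZ *)

Lemma look_store x y m z :
  look (store x y m) z = if z == x then y else look m z.
Proof.
rewrite /look /store; case: eqVneq => [->|zx]; first by rewrite PositiveMap.gss.
rewrite PositiveMap.gso // => /(congr1 N.pos).
by rewrite !N.succ_pos_spec => /N.succ_inj/eqP; rewrite (negbTE zx).
Qed.

Lemma mem_range x k y : (x <= y)%num -> (y < x + N.of_nat k)%num -> y \in range x k.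
Proof.
elim: k x => [|k IH] x le_xy lt_y /=; first lia.
rewrite inE; have [//|neq_yx] := eqVneq y x; apply: IH.
  by move/eqP: neq_yx; lia.
by lia.
Qed.

Section Residues.

Variable n : N.
Hypothesis n_gt1 : (1 < n)%num.
Notation Zn := 'Z_(N.to_nat n).

Definition toZ (x : N) : Zn := ((N.to_nat x)%:R)%R.
Definition ofZ (z : Zn) : N := N.of_nat z.

Lemma modulus_gt1 : 1 < N.to_nat n. Proof. lia. Qed.

Lemma ofZK z : toZ (ofZ z) = z.
Proof. by rewrite /toZ /ofZ Nnat.Nat2N.id natr_Zp. Qed.

Lemma ofZ_lt z : (ofZ z < n)%num.
Proof.
have := ltn_ord z; rewrite {2}(Zp_cast modulus_gt1) /ofZ.
by move: (nat_of_ord z) => m; lia.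
Qed.

Lemma toZK x : (x < n)%num -> ofZ (toZ x) = x.
Proof.
move=> lt_xn; rewrite /ofZ /toZ val_Zp_nat ?modulus_gt1 // modn_small; first lia.
lia.
Qed.

Lemma toZ_inj_lt x y : (x < n)%num -> (y < n)%num -> (toZ x == toZ y) = (x == y).
Proof.
move=> lt_x lt_y; apply/eqP/eqP => [E|-> //].
by rewrite -(toZK lt_x) E toZK.
Qed.

Lemma toZD x y : toZ (x + y) = (toZ x + toZ y)%R.
Proof. by rewrite /toZ Nnat.N2Nat.inj_add natrD. Qed.

Lemma toZM x y : toZ (x * y) = (toZ x * toZ y)%R.
Proof. by rewrite /toZ Nnat.N2Nat.inj_mul natrM. Qed.

Lemma toZ_mod x : toZ (x mod n) = toZ x.
Proof.
have n0 : toZ n = 0%R by rewrite /toZ pchar_Zp ?modulus_gt1.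
have n_neq0 : n <> 0%num by lia.
by rewrite {2}(N.div_mod x n n_neq0) toZD toZM n0 mul0r add0r.
Qed.

Lemma mem_range_ofZ z : ofZ z \in range 0 (N.to_nat n).
Proof. by apply: mem_range; have := ofZ_lt z; lia. Qed.

Definition tperms_perm (ts : seq (N * N)) : {perm Zn} :=
  \prod_(t <- ts) tperm (toZ t.1) (toZ t.2).

Definition tperms_ok (ts : seq (N * N)) : bool :=
  all (fun t => [&& ~~ N.eqb t.1 t.2, N.ltb t.1 n & N.ltb t.2 n]) ts.

Lemma tperms_perm_look ts x :
    tperms_ok ts -> (x < n)%num ->
  tperms_perm ts (toZ x) = toZ (look (table ts) x).
Proof.
rewrite /tperms_perm => ok_ts; elim: ts x ok_ts => [|[i j] ts IH] x /=.
  by rewrite big_nil perm1 /look PositiveMap.gempty.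
case/andP=> /and3P[_ /N.ltb_lt lt_i /N.ltb_lt lt_j] ok_ts lt_x.
rewrite big_cons permM !look_store /=.
have [->|neq_xi] := eqVneq x i; first by rewrite tpermL IH.
have [->|neq_xj] := eqVneq x j; first by rewrite tpermR IH.
by rewrite tpermD ?IH // eq_sym toZ_inj_lt.
Qed.

Lemma tperms_perm_even ts :
  tperms_ok ts -> ~~ odd (size ts) -> tperms_perm ts \in 'Alt_Zn.
Proof.
rewrite Alt_even => ok_ts; suff -> : odd_perm (tperms_perm ts) = odd (size ts) by [].
rewrite /tperms_perm; elim: ts ok_ts => [|[i j] ts IH] /=.
  by rewrite big_nil odd_perm1.
case/andP=> /and3P[/negbTE/N.eqb_neq/eqP neq_ij /N.ltb_lt lt_i /N.ltb_lt lt_j] /IH IHts.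
by rewrite big_cons odd_permM odd_tperm toZ_inj_lt // neq_ij IHts.
Qed.

Lemma alternates_sound (p : {perm Zn}) f r :
    (forall x, (x < n)%num -> (f x < n)%num /\ p (toZ x) = toZ (f x)) ->
  alternates n f r -> alternates_at p (toZ r).
Proof.
move=> pf; rewrite /alternates; move: (coloring _ _) => chi.
set bad := filter _ _ => le1.
(* [bad] has at most one element, the exceptional point; when it is empty, the default 0 serves. *)
exists (chi \o ofZ), (toZ (head 0%num bad)) => z neq_z /=.
have lt_zr : ((ofZ z + r) mod n < n)%num by apply: N.mod_lt; lia.
have [lt_f def_p] := pf _ lt_zr.
have -> : p (z + toZ r)%R = toZ (f ((ofZ z + r) mod n)%num).
  by rewrite -def_p toZ_mod toZD ofZK.
rewrite (toZK lt_f); have : ofZ z \notin bad.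
  apply: contra neq_z => bad_z; rewrite -{1}(ofZK z); apply/eqP; congr toZ.
  by move: le1 bad_z; case: bad => [|b []] //= _; rewrite inE => /eqP.
by rewrite mem_filter mem_range_ofZ andbT; case: (chi _) (chi _) => [] [].
Qed.

Lemma alternates_at_geom (p : {perm Zn}) u v r k j :
    (toZ v * toZ u = 1)%R -> (forall x, p (toZ u * x)%R = (toZ u * p x)%R) ->
    alternates_at p (toZ r) ->
  j \in geom n u r k -> alternates_at p (toZ j).
Proof.
move=> vu pu; elim: k r => [|k IH] r //= pr; rewrite inE => /predU1P[->//|].
by apply: IH; rewrite toZ_mod toZM; apply: alternates_at_mul vu pu pr.
Qed.

End Residues.

Lemma check_sound n u ra :
  check (n, u, ra) -> h_max (N.to_nat n) = (N.to_nat n - 1) %/ 2.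
Proof.
(* From here on [ts] is any list passing the tests, however it was obtained. *)
rewrite /check; move: (witness_tperms _) => ts.
case/and5P=> /andP[/N.ltb_lt n_gt1 odd_n] /andP[even_ts ok_ts] /allP fP
  /N.eqb_eq vu /andP[alt_r /eqP cover].
have n_gt1' := modulus_gt1 n_gt1.
pose p := tperms_perm n ts; pose f := look (table ts).
have pf x : (x < n)%num -> (f x < n)%num /\ p (toZ n x) = toZ n (f x).
  move=> lt_x; split; last exact: tperms_perm_look.
  have /fP/andP[/N.ltb_lt //] : x \in range 0 (N.to_nat n).
  by apply: mem_range; lia.
have alt_p r : r \in 0%num :: map fst ra -> alternates_at p (toZ n r).
  by move/allP: alt_r => /[apply]; apply: alternates_sound.
have pu z : p (toZ n u * z)%R = (toZ n u * p z)%R.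
  have /andP[_ /N.eqb_eq E] := fP _ (mem_range_ofZ n_gt1 z).
  have [_ pz] := pf _ (ofZ_lt n_gt1 z).
  have lt_uz : ((u * ofZ z) mod n < n)%num by apply: N.mod_lt; lia.
  have [_ puz] := pf _ lt_uz.
  move: puz; rewrite /f E !toZ_mod // !toZM // -/f -pz ofZK //.
(* The last entry of the list of powers is u^(k-1), an inverse of u because the check found u^k =
   1. *)
have vu1 : (toZ n (last u (geom n u 1 ((N.to_nat n).-1 %/ size ra))) * toZ n u = 1)%R.
  by rewrite -toZM // -(toZ_mod n_gt1) vu.
apply: (h_max_alternates n_gt1' odd_n (tperms_perm_even n_gt1 ok_ts even_ts)).
move=> j; rewrite -(ofZK j); have [->|j_neq0] := eqVneq (ofZ j) 0%num.
  by apply: alt_p; rewrite mem_head.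
(* A nonzero [j] lies in some coset r H, so its colouring is transported from that of the
   representative r. *)
have : ofZ j \in range 1 (N.to_nat n).-1.
  by apply: mem_range; have := ofZ_lt n_gt1 j; move/eqP: j_neq0; lia.
rewrite -cover mem_sort => /flattenP[_ /mapP[_ /mapP[[r a] ra_r ->] ->] /=].
apply: (alternates_at_geom n_gt1 vu1 pu); apply: alt_p.
by rewrite inE (map_f fst ra_r) orbT.
Qed.

Lemma check_witnesses : all check witnesses.
Proof. by vm_compute. Qed.

Theorem theorem5p7 (n : nat)
  (hn : n \in [:: 31; 43; 67; 79; 131; 139; 151; 163; 191; 199; 211; 223; 283;
                  307; 331; 367; 379; 439; 463; 487; 499; 523; 547; 607; 619;
                  643; 691; 727; 739; 751; 787; 811; 823; 859; 907; 919; 967]) :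
  h_max n = (n - 1) %/ 2.
Proof.
have : n \in [seq N.to_nat w.1.1 | w <- witnesses] by move: hn; vm_compute.
case/mapP=> -[[m u] ra] /(allP check_witnesses)/check_sound E ->; exact: E.
Qed.
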